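(* Let $V_1,V_2,M$ be complete lattices, and let $f\colon V_1\to M$ and $g\colon V_2\to M$ be complete sup-lattice morphisms (maps preserving arbitrary suprema) such that the images $f(V_1)$ and $g(V_2)$ are mutually distributive in $M$. Then there exists a unique complete sup-lattice morphism $h\colon V_1\otimes V_2\to M$ with $$h(x\odot y)=f(x)\wedge g(y)\qquad\text{for all }x\in V_1,\ y\in V_2.$$ Moreover, when $f$ and $g$ are complete lattice morphisms (preserving arbitrary suprema and arbitrary infima), so is $h$.
   Context: Concept lattice: for sets $G,M_0$ and a relation $\models\ \subseteq G\times M_0$, put $A'=\{m\mid a\models m\ \forall a\in A\}$ for $A\subseteq G$ and $B'=\{g\mid g\models b\ \forall b\in B\}$ for $B\subseteq M_0$; a concept is a pair $(A,B)$ with $A=B'$, $B=A'$ ($A$ is its extent), and concepts form a complete lattice ordered by inclusion of extents. Concept tensor: for complete lattices $V_1,V_2$, $V_1\otimes V_2$ is the concept lattice of the relation $\triangledown$ between $G=V_1\times V_2$ and $M_0=V_1\times V_2$ given by $(x,y)\mathrel{\triangledown}(w,z)$ iff $x\le w$ or $y\le z$. There are complete lattice embeddings $\varepsilon_i\colon V_i\to V_1\otimes V_2$, where $\varepsilon_1(x)$ has extent $\{(w,z)\mid w\le x\text{ or }z=0\}$ and $\varepsilon_2(y)$ has extent $\{(w,z)\mid z\le y\text{ or }w=0\}$. Define $x\odot y:=\varepsilon_1(x)\wedge\varepsilon_2(y)$, which is the concept with extent $\{(w,z)\mid (w\le x\text{ and }z\le y)\text{ or }w=0\text{ or }z=0\}$.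 Mutually distributive: subsets $X,Y$ of a complete lattice are mutually distributive when for all indexed families $(x_i)_{i\in I}\subseteq X$ and $(y_i)_{i\in I}\subseteq Y$, $$\bigvee_{i\in I}(x_i\wedge y_i)=\bigwedge_{J\subseteq I}\Big(\bigvee_{j\in J}x_j\vee\bigvee_{k\in I\setminus J}y_k\Big),\qquad \bigwedge_{i\in I}(x_i\vee y_i)=\bigvee_{J\subseteq I}\Big(\bigwedge_{j\in J}x_j\wedge\bigwedge_{k\in I\setminus J}y_k\Big).$$ *)

(* Defs.v *)
From HB Require Import structures.
From mathcomp Require Import all_boot all_order.
From mathcomp Require Import boolp classical_sets.

Set Implicit Arguments.
Unset Strict Implicit.
Unset Printing Implicit Defensive.

Import Order.TTheory.

Local Open Scope classical_set_scope.
Local Open Scope order_scope.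

HB.mixin Record isComplete d T of Order.TBLattice d T := {
  csup : set T -> T;
  cinf : set T -> T;
  csupP : forall A : set T, supremums A (csup A);
  cinfP : forall A : set T, infimums A (cinf A) }.

#[short(type="completeLatticeType")]
HB.structure Definition CompleteLattice d :=
  { T of Order.TBLattice d T & isComplete d T }.

Section CompleteLatticeTheory.
Context (d : Order.disp_t) (T : completeLatticeType d).
Implicit Types (x : T) (A : set T).

Lemma csup_ub A x : A x -> x <= csup A.
Proof. by case: (csupP A) => + _; apply. Qed.

Lemma csup_least A x : ubound A x -> csup A <= x.
Proof. by case: (csupP A) => _; apply. Qed.

Lemma cinf_lb A x : A x -> cinf A <= x.
Proof. by case: (cinfP A) => + _; apply. Qed.

Lemma cinf_greatest A x : lbound A x -> x <= cinf A.
Proof. by case: (cinfP A) => _; apply. Qed.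

End CompleteLatticeTheory.

(* [A] ranges over all subsets, the empty one included, so that sup-lattice
   morphisms preserve the bottom element. *)
Definition sup_morphism d1 d2 (V : completeLatticeType d1)
    (W : completeLatticeType d2) (f : V -> W) : Prop :=
  forall A : set V, f (csup A) = csup (f @` A).

Definition inf_morphism d1 d2 (V : completeLatticeType d1)
    (W : completeLatticeType d2) (f : V -> W) : Prop :=
  forall A : set V, f (cinf A) = cinf (f @` A).

Definition complete_lattice_morphism d1 d2 (V : completeLatticeType d1)
    (W : completeLatticeType d2) (f : V -> W) : Prop :=
  sup_morphism f /\ inf_morphism f.

Definition mutually_distributive d (M : completeLatticeType d) (X Y : set M) :
    Prop :=
  forall (I : Type) (x y : I -> M),
    (forall i, X (x i)) -> (forall i, Y (y i)) ->
    csup (range (fun i : I => x i `&` y i)) =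
      cinf (range (fun J : set I => csup (x @` J) `|` csup (y @` (~` J)%classic)))
    /\
    cinf (range (fun i : I => x i `|` y i)) =
      csup (range (fun J : set I => cinf (x @` J) `&` cinf (y @` (~` J)%classic))).

Section Concept.
Context (G N : Type) (R : G -> N -> Prop).

Definition common_attributes (A : set G) : set N :=
  [set m | forall a, A a -> R a m].

Definition common_objects (B : set N) : set G :=
  [set g | forall b, B b -> R g b].

(* [intent] is determined by [extent], so concepts are compared through their
   extents. *)
Record concept := Concept {
  extent : set G;
  intent : set N;
  extentE : extent = common_objects intent;
  intentE : intent = common_attributes extent }.

Lemma concept_ext (c e : concept) : extent c = extent e -> c = e.
Proof.
case: c e => A B AE BE [A' B' AE' BE'] /= eqA.
have eqB : B = B' by rewrite BE BE' eqA.
move: AE BE AE' BE'; rewrite -eqA -eqB => AE BE AE' BE'.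
by rewrite (Prop_irrelevance AE AE') (Prop_irrelevance BE BE').
Qed.

Lemma common_objectsK (A : set G) :
  common_attributes (common_objects (common_attributes A)) =
  common_attributes A.
Proof.
by rewrite eqEsubset; split=> m Am g; [move=> Ag; apply: Am => b; apply|apply].
Qed.

Lemma common_attributesK (B : set N) :
  common_objects (common_attributes (common_objects B)) = common_objects B.
Proof.
by rewrite eqEsubset; split=> g Bg m; [move=> Bm; apply: Bg => b; apply|apply].
Qed.

(* [(A'', A')], the least concept whose extent contains [A]. *)
Definition concept_of_objects (A : set G) : concept :=
  Concept (erefl (common_objects (common_attributes A)))
          (esym (common_objectsK A)).

(* [(B', B'')], the greatest concept whose intent contains [B]. *)
Definition concept_of_attributes (B : set N) : concept :=
  Concept (esym (common_attributesK B))
          (erefl (common_attributes (common_objects B))).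

Lemma sub_extent_intent (c e : concept) :
  (extent c `<=` extent e)%classic <-> (intent e `<=` intent c)%classic.
Proof.
split=> s x; first by rewrite !intentE => ex a /s; exact: ex.
by rewrite !extentE => cx b /s; exact: cx.
Qed.

Lemma concept_of_objects_le (A : set G) (c : concept) :
  (extent (concept_of_objects A) `<=` extent c)%classic <->
  (A `<=` extent c)%classic.
Proof.
split=> s g Ag; first by apply: s => b; apply.
by rewrite extentE => b cb; apply: Ag => a /s; rewrite extentE; apply.
Qed.

Definition concept_le (c e : concept) : bool :=
  `[< (extent c `<=` extent e)%classic >].

Lemma concept_le_refl : reflexive concept_le.
Proof. by move=> c; apply/asboolP. Qed.

Lemma concept_le_anti : antisymmetric concept_le.
Proof.
move=> c e /andP[/asboolP ce /asboolP ec].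
by apply: concept_ext; rewrite eqEsubset.
Qed.

Lemma concept_le_trans : transitive concept_le.
Proof.
move=> e c k /asboolP ce /asboolP ek.
by apply/asboolP; exact: subset_trans ek.
Qed.

Fact concept_display : Order.disp_t. Proof. exact: Order.Disp tt tt. Qed.

HB.instance Definition _ := gen_eqMixin concept.
HB.instance Definition _ := gen_choiceMixin concept.
HB.instance Definition _ := Order.Le_isPOrder.Build concept_display concept
  concept_le_refl concept_le_anti concept_le_trans.

Definition concept_sup (S : set concept) : concept :=
  concept_of_objects [set g | exists2 c, S c & extent c g].

Definition concept_inf (S : set concept) : concept :=
  concept_of_attributes [set m | exists2 c, S c & intent c m].

Lemma concept_leP (c e : concept) :
  reflect (extent c `<=` extent e)%classic (c <= e).
Proof. exact: asboolP. Qed.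

Lemma extent_concept_inf (S : set concept) :
  extent (concept_inf S) = [set g | forall c, S c -> extent c g].
Proof.
rewrite eqEsubset; split=> g Sg.
  by move=> c Sc; rewrite extentE => b cb; apply: Sg; exists c.
by move=> b [c /Sg]; rewrite extentE => + cb; apply.
Qed.

Lemma concept_supP (S : set concept) : supremums S (concept_sup S).
Proof.
split=> [c Sc|e eS]; apply/concept_leP.
  by have /concept_of_objects_le := @subset_refl _ (extent (concept_sup S));
    move=> s g cg; apply: s; exists c.
apply/concept_of_objects_le => g [c Sc cg].
by have /concept_leP := eS _ Sc; apply.
Qed.

Lemma concept_infP (S : set concept) : infimums S (concept_inf S).
Proof.
split=> [c Sc|e eS]; apply/concept_leP; rewrite extent_concept_inf => g.
  exact.
by move=> eg c /eS/concept_leP; apply.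
Qed.

Lemma concept_meetP (c e k : concept) :
  (c <= concept_inf [set e; k]) = (c <= e) && (c <= k).
Proof.
have [lb gl] := concept_infP [set e; k].
apply/idP/andP => [h|[ce ck]]; last by apply: gl => _ [->|->].
by split; apply: le_trans h _; apply: lb; [left|right].
Qed.

Lemma concept_joinP (c e k : concept) :
  (concept_sup [set c; e] <= k) = (c <= k) && (e <= k).
Proof.
have [ub lu] := concept_supP [set c; e].
apply/idP/andP => [h|[ck ek]]; last by apply: lu => _ [->|->].
by split; apply: le_trans h; apply: ub; [left|right].
Qed.

Lemma concept_le0x (c : concept) : concept_sup set0 <= c.
Proof. by case: (concept_supP set0) => _; apply. Qed.

Lemma concept_lex1 (c : concept) : c <= concept_inf set0.
Proof. by case: (concept_infP set0) => _; apply. Qed.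

HB.instance Definition _ := Order.POrder_MeetJoin_isLattice.Build
  concept_display concept concept_meetP concept_joinP.
HB.instance Definition _ :=
  Order.hasBottom.Build concept_display concept concept_le0x.
HB.instance Definition _ :=
  Order.hasTop.Build concept_display concept concept_lex1.
HB.instance Definition _ := isComplete.Build concept_display concept
  concept_supP concept_infP.

Lemma extentI (c e : concept) :
  extent (c `&` e) = (extent c `&` extent e)%classic.
Proof.
rewrite [extent _]extent_concept_inf eqEsubset; split=> g.
  by move=> h; split; apply: h; [left|right].
by move=> [cg eg] _ [->|->].
Qed.

End Concept.

Section ConceptTensor.
Context (d1 d2 : Order.disp_t).
Context (V1 : completeLatticeType d1) (V2 : completeLatticeType d2).

Definition triangledown (p q : V1 * V2) : Prop :=
  p.1 <= q.1 \/ p.2 <= q.2.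

Definition ctensor := concept triangledown.

HB.instance Definition _ := CompleteLattice.on ctensor.

Definition eps1_extent (x : V1) : set (V1 * V2) :=
  [set p | p.1 <= x \/ p.2 = \bot].
Definition eps1_intent (x : V1) : set (V1 * V2) :=
  [set q | x <= q.1 \/ q.2 = \top].
Definition eps2_extent (y : V2) : set (V1 * V2) :=
  [set p | p.2 <= y \/ p.1 = \bot].
Definition eps2_intent (y : V2) : set (V1 * V2) :=
  [set q | y <= q.2 \/ q.1 = \top].

Lemma eps1_extentE x :
  eps1_extent x = common_objects triangledown (eps1_intent x).
Proof.
rewrite eqEsubset; split=> -[w z] /=.
  move=> [wx|/= ->] [a b] [xa|/= ->]; rewrite /triangledown /=.
  - by left; exact: le_trans xa.
  - by right; exact: lex1.
  - by right; exact: le0x.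
  - by right; exact: lex1.
move=> /(_ (x, \bot))[|/= wx|/=]; [by left|by left|].
by rewrite lex0 => /eqP; right.
Qed.

Lemma eps1_intentE x :
  eps1_intent x = common_attributes triangledown (eps1_extent x).
Proof.
rewrite eqEsubset; split=> -[a b] /=.
  move=> [xa|/= ->] [w z] [wx|/= ->]; rewrite /triangledown /=.
  - by left; exact: le_trans xa.
  - by right; exact: le0x.
  - by right; exact: lex1.
  - by right; exact: le0x.
move=> /(_ (x, \top))[|/= xa|/=]; [by left|by left|].
by rewrite le1x => /eqP; right.
Qed.

Lemma eps2_extentE y :
  eps2_extent y = common_objects triangledown (eps2_intent y).
Proof.
rewrite eqEsubset; split=> -[w z] /=.
  move=> [zy|/= ->] [a b] [yb|/= ->]; rewrite /triangledown /=.
  - by right; exact: le_trans yb.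
  - by left; exact: lex1.
  - by left; exact: le0x.
  - by left; exact: le0x.
move=> /(_ (\bot, y))[|/=|/= zy]; [by left| |by left].
by rewrite lex0 => /eqP; right.
Qed.

Lemma eps2_intentE y :
  eps2_intent y = common_attributes triangledown (eps2_extent y).
Proof.
rewrite eqEsubset; split=> -[a b] /=.
  move=> [yb|/= ->] [w z] [zy|/= ->]; rewrite /triangledown /=.
  - by right; exact: le_trans yb.
  - by left; exact: le0x.
  - by left; exact: lex1.
  - by left; exact: le0x.
move=> /(_ (\top, y))[|/=|/= yb]; [by left| |by left].
by rewrite le1x => /eqP; right.
Qed.

Definition eps1 (x : V1) : ctensor := Concept (eps1_extentE x) (eps1_intentE x).
Definition eps2 (y : V2) : ctensor := Concept (eps2_extentE y) (eps2_intentE y).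

Definition odot (x : V1) (y : V2) : ctensor := eps1 x `&` eps2 y.

Lemma extent_odot x y :
  extent (odot x y) =
  [set p | [\/ p.1 <= x /\ p.2 <= y, p.1 = \bot | p.2 = \bot]].
Proof.
rewrite extentI eqEsubset; split=> -[w z] /=.
  move=> [[wx|/= ->]]; last by constructor 3.
  by move=> [zy|/= ->]; [constructor 1|constructor 2].
move=> [[wx zy]|/= ->|/= ->]; split; rewrite /eps1_extent /eps2_extent /=.
- by left.
- by left.
- by left; exact: le0x.
- by right.
- by right.
- by left; exact: le0x.
Qed.

End ConceptTensor.

Arguments ctensor {d1 d2} V1 V2.
Arguments odot {d1 d2 V1 V2} x y.

(* Main.v *)
(** The lift is h c = sup {f x /\ g y | (x, y) in the extent of c}, which is
    forced because c is the supremum of the x (.) y with (x, y) in its extent.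
    Mutual distributivity expands such a supremum over an arbitrary set A as an
    infimum, over J included in A, of f (sup of the first components of J) \/
    g (sup of the second components of A \ J), and each of these pairs of
    suprema is an attribute common to A.  Hence the supremum over A coincides
    with the one over the closure A'', so that h preserves suprema, and
    h c = inf {f w \/ g z | (w, z) in the intent of c}.  When f and g
    preserve infima, the dual expansion of the latter formula shows that h
    preserves infima as well. *)
Require Import Defs.
From HB Require Import structures.
From mathcomp Require Import all_boot all_order.
From mathcomp Require Import boolp classical_sets.

Set Implicit Arguments.
Unset Strict Implicit.
Unset Printing Implicit Defensive.

Import Order.TTheory.

Local Open Scope classical_set_scope.
Local Open Scope order_scope.

Lemma csup0 d (T : completeLatticeType d) : csup (@set0 T) = \bot.
Proof. by apply/eqP; rewrite -lex0; apply: csup_least. Qed.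

Lemma csup_set2 d (T : completeLatticeType d) (x y : T) :
  csup [set x; y] = x `|` y.
Proof.
apply: le_anti; rewrite leUx !csup_ub ?andbT; [|by right|by left].
by apply: csup_least => _ [->|->]; [exact: leUl|exact: leUr].
Qed.

Section SupMorphism.
Context (d1 d2 : Order.disp_t).
Context (V : completeLatticeType d1) (W : completeLatticeType d2) (f : V -> W).
Hypothesis hf : sup_morphism f.

Lemma sup_morphism_le : {homo f : x y / x <= y}.
Proof.
move=> x y /join_r <-; rewrite -csup_set2 hf.
by apply: csup_ub; exists x => //; left.
Qed.

Lemma sup_morphism0 : f \bot = \bot.
Proof. by rewrite -csup0 hf image_set0 csup0. Qed.

End SupMorphism.

Section TensorLift.
Context (d1 d2 d : Order.disp_t).
Context (V1 : completeLatticeType d1) (V2 : completeLatticeType d2).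
Context (M : completeLatticeType d) (f : V1 -> M) (g : V2 -> M).

Local Notation attributes := (common_attributes (@triangledown _ _ V1 V2)).
Local Notation objects := (common_objects (@triangledown _ _ V1 V2)).

(** Extents are closed downwards and contain every pair with a component [\bot], so the extent of
    [odot p.1 p.2] lies in that of [c] as soon as [p] does. *)
Lemma ctensor_csup_odot (c : ctensor V1 V2) :
  c = csup ((fun p => odot p.1 p.2) @` extent c).
Proof.
apply: le_anti; apply/andP; split.
  apply/concept_leP => p cp.
  have /concept_leP : odot p.1 p.2 <=
      csup ((fun p => odot p.1 p.2) @` extent c) by apply: csup_ub; exists p.
  by apply; rewrite extent_odot; constructor 1.
apply: csup_least => _ [p cp <-]; apply/concept_leP => q.
rewrite extent_odot extentE => pq r cr.
have pr : triangledown p r by move: cp; rewrite extentE; apply.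
case: pq => [[q1 q2]|q1|q2].
- by case: pr => pr; [left; exact: le_trans pr|right; exact: le_trans pr].
- by left; rewrite q1 le0x.
- by right; rewrite q2 le0x.
Qed.

Definition tensor_lift (c : ctensor V1 V2) : M :=
  csup ((fun p => f p.1 `&` g p.2) @` extent c).

Lemma tensor_lift_unique (h : ctensor V1 V2 -> M) :
  sup_morphism h -> (forall x y, h (odot x y) = f x `&` g y) ->
  h = tensor_lift.
Proof.
move=> hh ho; apply/funext => c; rewrite [in LHS](ctensor_csup_odot c) hh.
rewrite image_comp; congr csup; apply: eq_imagel => p _; exact: ho.
Qed.

Hypotheses (hf : sup_morphism f) (hg : sup_morphism g).

Lemma meet_le_join p q :
  triangledown p q -> f p.1 `&` g p.2 <= f q.1 `|` g q.2.
Proof.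
case=> [/(sup_morphism_le hf)|/(sup_morphism_le hg)] pq.
  exact: leIxl (lexUl _ pq).
exact: leIxr (lexUr _ pq).
Qed.

Lemma tensor_lift_le (c e : ctensor V1 V2) :
  c <= e -> tensor_lift c <= tensor_lift e.
Proof.
move=> /concept_leP ce; apply: csup_least => _ [p /ce ep <-].
by apply: csup_ub; exists p.
Qed.

(** The pairs with a component [\bot] contribute [\bot], as [f] and [g] preserve the empty supremum;
    among the others [(x, y)] is the greatest. *)
Lemma tensor_lift_odot x y : tensor_lift (odot x y) = f x `&` g y.
Proof.
rewrite /tensor_lift extent_odot; apply: le_anti; apply/andP; split.
  apply: csup_least => _ [[w z] /= [[wx zy]|->|->] <-].
  - exact: leI2 (sup_morphism_le hf wx) (sup_morphism_le hg zy).
  - by rewrite (sup_morphism0 hf) meet0x le0x.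
  - by rewrite (sup_morphism0 hg) meetx0 le0x.
by apply: csup_ub; exists (x, y) => //; constructor 1.
Qed.

Hypothesis hfg : mutually_distributive (range f) (range g).

(** Converse to [meet_le_join]: together they equate the supremum over [A] with the infimum over the
    attributes of [A]. *)
Lemma le_csup_meet (A : set (V1 * V2)) (u : M) :
  (forall q, attributes A q -> u <= f q.1 `|` g q.2) ->
  u <= csup ((fun p => f p.1 `&` g p.2) @` A).
Proof.
move=> uA.
(* Mutual distributivity is stated for families, so [A] is indexed by its own elements. *)
have [||dist _] := hfg (x := fun i : {p | A p} => f (sval i).1)
  (y := fun i => g (sval i).2); try by move=> i; eexists.
have -> : (fun p => f p.1 `&` g p.2) @` A =
    range (fun i : {p | A p} => f (sval i).1 `&` g (sval i).2).
  rewrite eqEsubset; split=> [_ [p Ap <-]|_ [[p Ap] _ <-]]; last by exists p.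
  by exists (exist _ p Ap).
rewrite dist; apply: cinf_greatest => _ [J _ <-].
rewrite -(image_comp (fun i => (sval i).1) f) -hf.
rewrite -(image_comp (fun i => (sval i).2) g) -hg.
(* The placeholders are the suprema of the first components over [J] and of the second components
   over its complement; the index of [p] lies in one of the two. *)
apply: (uA (_, _)) => p Ap.
have [Jp|nJp] := pselect (J (exist _ p Ap)); [left|right];
  by apply: csup_ub; exists (exist _ p Ap).
Qed.

(** Dual of [le_csup_meet]: preservation of infima turns each term of the expansion into the meet
    attached to a common object of [B]. *)
Lemma cinf_join_le (B : set (V1 * V2)) (u : M) :
  inf_morphism f -> inf_morphism g ->
  (forall p, objects B p -> f p.1 `&` g p.2 <= u) ->
  cinf ((fun q => f q.1 `|` g q.2) @` B) <= u.
Proof.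
move=> inff infg uB.
have [||_ dist] := hfg (x := fun i : {q | B q} => f (sval i).1)
  (y := fun i => g (sval i).2); try by move=> i; eexists.
have -> : (fun q => f q.1 `|` g q.2) @` B =
    range (fun i : {q | B q} => f (sval i).1 `|` g (sval i).2).
  rewrite eqEsubset; split=> [_ [q Bq <-]|_ [[q Bq] _ <-]]; last by exists q.
  by exists (exist _ q Bq).
rewrite dist; apply: csup_least => _ [J _ <-].
rewrite -(image_comp (fun i => (sval i).1) f) -inff.
rewrite -(image_comp (fun i => (sval i).2) g) -infg.
apply: (uB (_, _)) => q Bq.
have [Jq|nJq] := pselect (J (exist _ q Bq)); [left|right];
  by apply: cinf_lb; exists (exist _ q Bq).
Qed.

Lemma tensor_lift_sup : sup_morphism tensor_lift.
Proof.
move=> S; apply: le_anti; apply/andP; split; last first.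
  by apply: csup_least => _ [c Sc <-]; apply: tensor_lift_le; exact: csup_ub.
have /le_trans -> // : tensor_lift (csup S) <= csup ((fun p => f p.1 `&` g p.2)
    @` [set p | exists2 c, S c & extent c p]).
  apply: csup_least => _ [p Sp <-]; apply: le_csup_meet => q Sq.
  (* By construction the extent of [csup S] consists of the objects of all attributes common to the
     union of the extents. *)
  by apply: meet_le_join; exact: Sp.
apply: csup_least => _ [p [c Sc cp] <-].
apply: (@le_trans _ _ (tensor_lift c)); first by apply: csup_ub; exists p.
by apply: csup_ub; exists c.
Qed.

Lemma tensor_lift_intent (c : ctensor V1 V2) :
  tensor_lift c = cinf ((fun q => f q.1 `|` g q.2) @` intent c).
Proof.
apply: le_anti; apply/andP; split.
  apply: csup_least => _ [p cp <-]; apply: cinf_greatest => _ [q cq <-].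
  by apply: meet_le_join; move: cp; rewrite extentE; apply.
by apply: le_csup_meet => q; rewrite -intentE => cq; apply: cinf_lb; exists q.
Qed.

Lemma tensor_lift_inf :
  inf_morphism f -> inf_morphism g -> inf_morphism tensor_lift.
Proof.
move=> inff infg S; apply: le_anti; apply/andP; split.
  by apply: cinf_greatest => _ [c Sc <-]; apply: tensor_lift_le; exact: cinf_lb.
apply: (@le_trans _ _ (cinf ((fun q => f q.1 `|` g q.2)
    @` [set q | exists2 c, S c & intent c q]))).
  apply: cinf_greatest => _ [q [c Sc cq] <-].
  apply: (@le_trans _ _ (tensor_lift c)); first by apply: cinf_lb; exists c.
  by rewrite tensor_lift_intent; apply: cinf_lb; exists q.
(* The objects common to the union of the intents form the extent of [cinf S]. *)
by apply: cinf_join_le => // p Sp; apply: csup_ub; exists p.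
Qed.

End TensorLift.

Theorem proposition30 (d1 d2 d : Order.disp_t)
    (V1 : completeLatticeType d1) (V2 : completeLatticeType d2)
    (M : completeLatticeType d) (f : V1 -> M) (g : V2 -> M)
    (hf : sup_morphism f) (hg : sup_morphism g)
    (hfg : mutually_distributive (range f) (range g)) :
  (exists! h : ctensor V1 V2 -> M,
     sup_morphism h /\
     forall (x : V1) (y : V2), h (odot x y) = (f x `&` g y)%O) /\
  (forall h : ctensor V1 V2 -> M,
     sup_morphism h ->
     (forall (x : V1) (y : V2), h (odot x y) = (f x `&` g y)%O) ->
     complete_lattice_morphism f -> complete_lattice_morphism g ->
     complete_lattice_morphism h).
Proof.
split=> [|h hh ho [_ inff] [_ infg]].
  exists (tensor_lift f g); split=> [|h [hh ho]].
    by split; [exact: tensor_lift_sup|exact: tensor_lift_odot].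
  by rewrite (tensor_lift_unique hh ho).
by split=> //; rewrite (tensor_lift_unique hh ho); exact: tensor_lift_inf.
Qed.
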